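(* Let $X:I\times J\to\mathbb{S}^3$, $X(s,t)=\alpha(s)\cdot\beta(t)$, be a translation surface, where $\alpha,\beta$ are arc length curves in $\mathbb{S}^3$. If $\langle T_\alpha,T_\beta\rangle=C$ is constant, then this surface is flat. Moreover, up to interchanging the roles of $\alpha$ and $\beta$, one has $\kappa_\beta\equiv0$ and either $\kappa_\alpha\equiv0$ or $\alpha$ is a general helix satisfying $\tau_\alpha=\frac{C}{\eta}\kappa_\alpha+1$ for some constant $\eta\in\mathbb{R}$, $\eta\neq0$. (With the roles interchanged this reads: $\kappa_\alpha\equiv0$ and either $\kappa_\beta\equiv0$ or $\beta$ is a general helix satisfying $\tau_\beta=\frac{C}{\eta}\kappa_\beta-1$ for some constant $\eta\neq0$.)
   Context: $\mathbb{R}^4$ is identified with the quaternions, ''$\cdot$'' is quaternion multiplication, $\overline{x}$ is conjugation, $\langle\cdot,\cdot\rangle$ is the Euclidean inner product, and $\mathbb{S}^3$ is the group of unit quaternions with the induced metric. A translation surface is a regular surface locally parametrized by $X(s,t)=\alpha(s)\cdot\beta(t)$. For an arc length curve $\gamma$ in $\mathbb{S}^3$: $t_\gamma=\gamma'$, $\kappa_\gamma=|\nabla_{\gamma'}\gamma'|$; where $\kappa_\gamma\neq0$, $n_\gamma=\kappa_\gamma^{-1}\nabla_{\gamma'}\gamma'$, $b_\gamma\in T_\gamma\mathbb{S}^3$ is the unit vector orthogonal to $t_\gamma,n_\gamma$ with $\det(\gamma,t_\gamma,n_\gamma,b_\gamma)>0$, and the torsion $\tau_\gamma$ is defined by $\nabla_{t_\gamma}n_\gamma=-\kappa_\gamma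 t_\gamma+\tau_\gamma b_\gamma$. For the first generating curve $T_\alpha=\overline{\alpha}\cdot\alpha'$, for the second $T_\beta=\beta\cdot\overline{\beta'}$; both are purely imaginary unit quaternions. Regularity of $X$ means $\langle T_\alpha,T_\beta\rangle\ne\pm1$. A curve $\gamma$ in $\mathbb{S}^3$ is a general helix if there is a Killing vector field $V$ of constant length along $\gamma$ such that the angle between $V$ and $\gamma'$ is a nonzero constant along $\gamma$. Equivalently (known theorem of Barros), either $\tau_\gamma\equiv0$ and $\gamma$ lies in some unit 2-sphere, or $\tau_\gamma=b\kappa_\gamma\pm1$ for some constant $b$. A surface is flat if its Gaussian curvature vanishes identically.
   Formalization: The torsion relation is asserted on each interval where the curvature has no zero, with η depending on that interval (a single η if the curvature never vanishes); one η for the whole curve can fail, as the sign of η may change across a zero of the curvature. *)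

(* Defs.v *)
From HB Require Import structures.
From mathcomp Require Import all_boot all_order all_algebra.
From mathcomp Require Import all_classical all_reals all_analysis.

Set Implicit Arguments.
Unset Strict Implicit.
Unset Printing Implicit Defensive.

Import Order.TTheory GRing.Theory Num.Theory.
Import numFieldNormedType.Exports.

Local Open Scope classical_set_scope.
Local Open Scope ring_scope.

(* The quaternion a + b i + c j + d k is the row vector (a, b, c, d).  The
   numerals 0, 1, 2, 3 in [x 0 k] are elements of the ring 'I_4 = Z/4Z. *)
Section Quaternions.
Variable R : realType.
Implicit Types x y : 'rV[R]_4.

Definition quat (a b c d : R) : 'rV[R]_4 :=
  \row_(k < 4) nth 0 [:: a; b; c; d] k.

Definition qmul x y : 'rV[R]_4 :=
  quat (x 0 0 * y 0 0 - x 0 1 * y 0 1 - x 0 2 * y 0 2 - x 0 3 * y 0 3)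
       (x 0 0 * y 0 1 + x 0 1 * y 0 0 + x 0 2 * y 0 3 - x 0 3 * y 0 2)
       (x 0 0 * y 0 2 - x 0 1 * y 0 3 + x 0 2 * y 0 0 + x 0 3 * y 0 1)
       (x 0 0 * y 0 3 + x 0 1 * y 0 2 - x 0 2 * y 0 1 + x 0 3 * y 0 0).

Definition qconj x : 'rV[R]_4 := quat (x 0 0) (- x 0 1) (- x 0 2) (- x 0 3).

Definition dot x y : R := \sum_(k < 4) x 0 k * y 0 k.

(* MathComp-Analysis's norm `|x| on row vectors is the maximum norm, so the
   Euclidean norm has to be introduced separately. *)
Definition enorm x : R := Num.sqrt (dot x x).

Definition S3 : set 'rV[R]_4 := [set x | enorm x = 1].

Definition det4 (x y z w : 'rV[R]_4) : R :=
  \det (\matrix_(i < 4) nth 0 [:: x; y; z; w] i).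

Definition angle x y : R := acos (dot x y / (enorm x * enorm y)).

End Quaternions.

Section Curves.
Variable R : realType.
Implicit Types (I : set R) (g W : R -> 'rV[R]_4) (s : R).

Definition open_interval I : Prop := [/\ open I, is_interval I & I !=set0].

Definition smooth_on I g : Prop :=
  forall (n : nat) s, I s -> derivable (derive1n n g) s 1.

Definition arc_length_curve I g : Prop :=
  [/\ smooth_on I g,
      forall s, I s -> S3 (g s)
    & forall s, I s -> enorm (derive1 g s) = 1].

(* Levi-Civita derivative on S^3 of a field W along g: the part of W' that is
   tangent to the sphere. *)
Definition cov g W s : 'rV[R]_4 :=
  derive1 W s - dot (derive1 W s) (g s) *: g s.

Definition curvature g s : R := enorm (cov g (derive1 g) s).

Definition normal g s : 'rV[R]_4 := (curvature g s)^-1 *: cov g (derive1 g) s.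

Definition is_binormal g s (b : 'rV[R]_4) : Prop :=
  [/\ dot b (g s) = 0, dot b (derive1 g s) = 0, dot b (normal g s) = 0,
      enorm b = 1
    & 0 < det4 (g s) (derive1 g s) (normal g s) b].

(* The torsion only makes sense where the curvature does not vanish; there it
   is unique, as the binormal is. *)
Definition is_torsion g s (tau : R) : Prop :=
  curvature g s != 0 /\
  exists2 b, is_binormal g s b &
    cov g (normal g) s = - curvature g s *: derive1 g s + tau *: b.

(* All iterated directional derivatives are differentiable. *)
Definition smooth_field (V : 'rV[R]_4 -> 'rV[R]_4) : Prop :=
  forall (us : seq 'rV[R]_4) (p : 'rV[R]_4),
    differentiable (foldr (fun u F q => derive F q u) V us) p.

(* A vector field on S^3 is given by a smooth extension V to R^4 (one always
   exists).  For tangent u, w at p the tangential part of 'D_u V p is the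
   Levi-Civita derivative, and the normal part does not contribute to the
   inner product with w, so the last clause is the Killing equation of S^3;
   it does not depend on the extension. *)
Definition killing_field (V : 'rV[R]_4 -> 'rV[R]_4) : Prop :=
  [/\ smooth_field V,
      forall p, S3 p -> dot (V p) p = 0
    & forall p u w, S3 p -> dot u p = 0 -> dot w p = 0 ->
        dot (derive V p u) w + dot u (derive V p w) = 0].

Definition general_helix I g : Prop :=
  exists V : 'rV[R]_4 -> 'rV[R]_4,
    [/\ killing_field V,
        exists2 l : R, 0 < l & forall s, I s -> enorm (V (g s)) = l
      & exists2 theta : R, theta != 0 &
          forall s, I s -> angle (V (g s)) (derive1 g s) = theta].

End Curves.

Section Patches.
Variable R : realType.
Implicit Types (I J : set R) (X : R -> R -> 'rV[R]_4) (s t : R).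

Definition partial (V : normedModType R) (i : 'I_2) (f : R -> R -> V) :
    R -> R -> V :=
  fun s t => if i == 0 then derive1 (fun s' => f s' t) s else derive1 (f s) t.

Definition regular_patch I J X : Prop :=
  forall s t, I s -> J t -> forall a b : R,
    a *: partial 0 X s t + b *: partial 1 X s t = 0 -> a = 0 /\ b = 0.

Definition metric X (i j : 'I_2) : R -> R -> R^o :=
  fun s t => dot (partial i X s t) (partial j X s t).

Definition metric_mx X s t : 'M[R]_2 := \matrix_(i, j) metric X i j s t.

(* Gamma^k_ij *)
Definition christoffel X (k i j : 'I_2) : R -> R -> R^o :=
  fun s t => 2^-1 * \sum_(l < 2) invmx (metric_mx X s t) k l *
    (partial i (metric X j l) s t + partial j (metric X i l) s t
     - partial l (metric X i j) s t).

(* The coefficient along d_l of Rm(d_i, d_j) d_k, where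
   Rm(U, V) W = D_U D_V W - D_V D_U W - D_[U, V] W. *)
Definition riemann X (l i j k : 'I_2) s t : R :=
  partial i (christoffel X l j k) s t - partial j (christoffel X l i k) s t
  + \sum_(m < 2) (christoffel X m j k s t * christoffel X l i m s t
                  - christoffel X m i k s t * christoffel X l j m s t).

(* <Rm(d_0, d_1) d_1, d_0> / det g, for the metric induced on the patch. *)
Definition gauss_curvature X s t : R :=
  (\sum_(l < 2) metric X 0 l s t * riemann X l 0 1 1 s t)
    / \det (metric_mx X s t).

Definition flat I J X : Prop :=
  forall s t, I s -> J t -> gauss_curvature X s t = 0.

End Patches.

Section TranslationSurfaces.
Variable R : realType.
Implicit Types (I J : set R) (alpha beta : R -> 'rV[R]_4).

Definition tsurf alpha beta : R -> R -> 'rV[R]_4 :=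
  fun s t => qmul (alpha s) (beta t).

Definition translation_surface I J alpha beta : Prop :=
  [/\ open_interval I, open_interval J, arc_length_curve I alpha,
      arc_length_curve J beta & regular_patch I J (tsurf alpha beta)].

Definition T_first alpha (s : R) : 'rV[R]_4 :=
  qmul (qconj (alpha s)) (derive1 alpha s).

Definition T_second beta (t : R) : 'rV[R]_4 :=
  qmul (beta t) (qconj (derive1 beta t)).

(* kappa vanishes identically, or g is a general helix with
   tau = (C / eta) kappa + e.  The torsion relation is asserted on every
   interval where the Frenet frame exists, in particular on all of I if kappa
   has no zero.  The constant eta cannot be chosen before K: when kappa has
   isolated zeros the sign of eta may change across them, since kappa is
   nonnegative and n jumps to its opposite there. *)
Definition geodesic_or_helix I (C e : R) (g : R -> 'rV[R]_4) : Prop :=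
  (forall s, I s -> curvature g s = 0) \/
  (general_helix I g /\
   forall K : set R, is_interval K -> K `<=` I ->
     (forall s, K s -> curvature g s != 0) ->
     exists2 eta : R, eta != 0 &
       forall s, K s -> is_torsion g s (C / eta * curvature g s + e)).

End TranslationSurfaces.

(* Main.v *)
(* Write alpha' = alpha T_alpha.  As T_alpha is an imaginary unit,
   alpha'' = - alpha + alpha T_alpha', so kappa_alpha = |T_alpha'|; the same
   applies to the conjugate of beta, whose logarithmic derivative is T_beta.  If
   T_alpha' and T_beta' were nonzero at some s and t, T_alpha and T_beta would be
   orthogonal to the two orthogonal vectors T_alpha', T_beta' there, hence
   parallel, against regularity.  Say kappa_beta = 0 and put u = T_beta (t0).
   Then <T_alpha, u> = C, so alpha makes a constant angle with the Killing field
   p |-> p u, and expanding u in the frame T, T', T T' gives the torsion, with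
   eta = <u, T T'> / |T'|; eta^2 = 1 - C^2, and eta has constant sign where
   kappa_alpha has no zero.  The surface is flat because its first fundamental
   form is constant. *)
Require Import Defs.
From HB Require Import structures.
From mathcomp Require Import all_boot all_order all_algebra.
From mathcomp Require Import all_classical all_reals all_analysis.
From mathcomp Require Import ring lra.

Set Implicit Arguments.
Unset Strict Implicit.
Unset Printing Implicit Defensive.

Import Order.TTheory GRing.Theory Num.Theory.
Import numFieldNormedType.Exports.

Local Open Scope classical_set_scope.
Local Open Scope ring_scope.

(** * Coordinates and quaternion algebra *)

Lemma I4_case (P : 'I_4 -> Prop) : P 0 -> P 1 -> P 2 -> P 3 -> forall i, P i.
Proof.
by move=> P0 P1 P2 P3 [[|[|[|[|//]]]] lt_i];
  [move: P0|move: P1|move: P2|move: P3]; congr (P _); exact: val_inj.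
Qed.

Lemma rV4P (R : realType) (x y : 'rV[R]_4) :
  x 0 0 = y 0 0 -> x 0 1 = y 0 1 -> x 0 2 = y 0 2 -> x 0 3 = y 0 3 -> x = y.
Proof. by move=> *; apply/rowP; elim/I4_case. Qed.

Lemma quatE (R : realType) (a b c d : R) :
  (quat a b c d 0 0 = a) * (quat a b c d 0 1 = b) *
  (quat a b c d 0 2 = c) * (quat a b c d 0 3 = d).
Proof. by rewrite /quat !mxE. Qed.

Lemma rV4D (R : realType) (x y : 'rV[R]_4) (i : 'I_4) :
  (x + y) 0 i = x 0 i + y 0 i.
Proof. by rewrite mxE. Qed.

Lemma rV4N (R : realType) (x : 'rV[R]_4) (i : 'I_4) : (- x) 0 i = - x 0 i.
Proof. by rewrite mxE. Qed.

Lemma rV4Z (R : realType) (k : R) (x : 'rV[R]_4) (i : 'I_4) :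
  (k *: x) 0 i = k * x 0 i.
Proof. by rewrite mxE. Qed.

Lemma rV40 (R : realType) (i : 'I_4) : (0 : 'rV[R]_4) 0 i = 0.
Proof. by rewrite mxE. Qed.

Lemma qmulE (R : realType) (x y : 'rV[R]_4) :
  (qmul x y 0 0 = x 0 0 * y 0 0 - x 0 1 * y 0 1 - x 0 2 * y 0 2
                  - x 0 3 * y 0 3) *
  (qmul x y 0 1 = x 0 0 * y 0 1 + x 0 1 * y 0 0 + x 0 2 * y 0 3
                  - x 0 3 * y 0 2) *
  (qmul x y 0 2 = x 0 0 * y 0 2 - x 0 1 * y 0 3 + x 0 2 * y 0 0
                  + x 0 3 * y 0 1) *
  (qmul x y 0 3 = x 0 0 * y 0 3 + x 0 1 * y 0 2 - x 0 2 * y 0 1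
                  + x 0 3 * y 0 0).
Proof. by rewrite /qmul !quatE. Qed.

Lemma qconjE (R : realType) (x : 'rV[R]_4) :
  (qconj x 0 0 = x 0 0) * (qconj x 0 1 = - x 0 1) *
  (qconj x 0 2 = - x 0 2) * (qconj x 0 3 = - x 0 3).
Proof. by rewrite /qconj !quatE. Qed.

Lemma dotE (R : realType) (x y : 'rV[R]_4) :
  dot x y = x 0 0 * y 0 0 + x 0 1 * y 0 1 + x 0 2 * y 0 2 + x 0 3 * y 0 3.
Proof.
rewrite /dot !big_ord_recr big_ord0 /= add0r.
by congr (_ + _ + _ + _); congr (x 0 _ * y 0 _); exact: val_inj.
Qed.

(** Rewriting with this list turns an identity of quaternions into polynomial identities in the
    coordinates, which [ring] decides. *)
Definition coordE := (quatE, qmulE, qconjE, dotE, rV4D, rV4N, rV4Z, rV40).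

Lemma qmulA (R : realType) (x y z : 'rV[R]_4) :
  qmul x (qmul y z) = qmul (qmul x y) z.
Proof. by apply: rV4P; rewrite !coordE; ring. Qed.

Lemma qmulDr (R : realType) (x y z : 'rV[R]_4) :
  qmul x (y + z) = qmul x y + qmul x z.
Proof. by apply: rV4P; rewrite !coordE; ring. Qed.

Lemma qmulZr (R : realType) (k : R) (x y : 'rV[R]_4) :
  qmul x (k *: y) = k *: qmul x y.
Proof. by apply: rV4P; rewrite !coordE; ring. Qed.

Lemma qmulKl (R : realType) (x y : 'rV[R]_4) :
  qmul x (qmul (qconj x) y) = dot x x *: y.
Proof. by apply: rV4P; rewrite !coordE; ring. Qed.

Lemma qmul_sqr_imag (R : realType) (x y : 'rV[R]_4) : y 0 0 = 0 ->
  qmul x (qmul y y) = - dot y y *: x.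
Proof. by move=> y0; apply: rV4P; rewrite !coordE y0; ring. Qed.

Lemma qconjK (R : realType) : involutive (@qconj R).
Proof. by move=> x; apply: rV4P; rewrite !coordE ?opprK. Qed.

(** * Inner product, frames and orientation *)

Lemma dotC (R : realType) (x y : 'rV[R]_4) : dot x y = dot y x.
Proof. by rewrite !coordE; ring. Qed.

Lemma dotDl (R : realType) (x y z : 'rV[R]_4) :
  dot (x + y) z = dot x z + dot y z.
Proof. by rewrite !coordE; ring. Qed.

Lemma dotDr (R : realType) (x y z : 'rV[R]_4) :
  dot x (y + z) = dot x y + dot x z.
Proof. by rewrite !coordE; ring. Qed.

Lemma dot0r (R : realType) (x : 'rV[R]_4) : dot x 0 = 0.
Proof. by rewrite !coordE; ring. Qed.

Lemma dotZl (R : realType) (k : R) (x y : 'rV[R]_4) :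
  dot (k *: x) y = k * dot x y.
Proof. by rewrite !coordE; ring. Qed.

Lemma dotZr (R : realType) (k : R) (x y : 'rV[R]_4) :
  dot x (k *: y) = k * dot x y.
Proof. by rewrite !coordE; ring. Qed.

(** Polarized multiplicativity of the norm: left translation by a unit quaternion is an isometry. *)
Lemma dot_qmul2l (R : realType) (x y z : 'rV[R]_4) :
  dot (qmul x y) (qmul x z) = dot x x * dot y z.
Proof. by rewrite !coordE; ring. Qed.

Lemma dot_qmul_l (R : realType) (x y : 'rV[R]_4) :
  dot (qmul x y) x = dot x x * y 0 0.
Proof. by rewrite !coordE; ring. Qed.

Lemma dot_qmul2r (R : realType) (x y z : 'rV[R]_4) :
  dot (qmul x z) (qmul y z) = dot x y * dot z z.
Proof. by rewrite !coordE; ring. Qed.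

Lemma dot_qconj (R : realType) (x y : 'rV[R]_4) :
  dot (qconj x) (qconj y) = dot x y.
Proof. by rewrite !coordE; ring. Qed.

Lemma dot_ge0 (R : realType) (x : 'rV[R]_4) : 0 <= dot x x.
Proof. by rewrite sumr_ge0// => i _; rewrite -expr2 sqr_ge0. Qed.

Lemma dot_eq0 (R : realType) (x : 'rV[R]_4) : (dot x x == 0) = (x == 0).
Proof.
apply/eqP/eqP => [|->]; last by rewrite !coordE; ring.
move=> xx; apply/rowP => i; rewrite mxE; apply/eqP; rewrite -sqrf_eq0 expr2.
move/eqP: xx; rewrite psumr_eq0 => [/allP/(_ i)|j _]; last first.
  by rewrite -expr2 sqr_ge0.
by rewrite mem_index_enum => /(_ isT).
Qed.

Lemma enorm_sqr (R : realType) (x : 'rV[R]_4) : enorm x ^+ 2 = dot x x.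
Proof. by rewrite sqr_sqrtr// dot_ge0. Qed.

Lemma enorm_eq0 (R : realType) (x : 'rV[R]_4) : (enorm x == 0) = (x == 0).
Proof. by rewrite -sqrf_eq0 enorm_sqr dot_eq0. Qed.

Lemma enorm_eq1 (R : realType) (x : 'rV[R]_4) : enorm x = 1 <-> dot x x = 1.
Proof.
split=> [x1|x1]; first by rewrite -enorm_sqr x1 expr1n.
by rewrite /enorm x1 sqrtr1.
Qed.

(* Cramer's rule for imaginary quaternions in the frame a, p, a x p, where
   a x p = a p since a and p are orthogonal. *)
Lemma frame_decomp (R : realType) (a p x : 'rV[R]_4) :
  a 0 0 = 0 -> p 0 0 = 0 -> x 0 0 = 0 -> dot a a = 1 -> dot p a = 0 ->
  dot p p *: x = (dot p p * dot x a) *: a + dot x p *: p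
                 + dot x (qmul a p) *: qmul a p.
Proof.
move=> a0 p0 x0 aa pa.
(* [c] is the cross product a x p of the imaginary parts; for imaginary a and p the product a p is a
   x p - <a, p>. *)
pose c : 'rV[R]_4 := quat 0 (a 0 2 * p 0 3 - a 0 3 * p 0 2)
  (a 0 3 * p 0 1 - a 0 1 * p 0 3) (a 0 1 * p 0 2 - a 0 2 * p 0 1).
have -> : qmul a p = c.
  transitivity (c - dot p a *: quat 1 0 0 0); last by rewrite pa scale0r subr0.
  by apply: rV4P; rewrite /c !coordE a0 p0; ring.
transitivity ((dot a a * dot p p - dot p a ^+ 2) *: x).
  by rewrite aa pa expr0n subr0 mul1r.
(* Cramer's identity for arbitrary imaginary a, p, x, with the Gram determinant of a and p in front
   of x; |a| = 1 and <p, a> = 0 are inserted afterwards. *)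
transitivity ((dot p p * dot x a - dot x p * dot p a) *: a
  + (dot a a * dot x p - dot x a * dot p a) *: p + dot x c *: c).
  by clear aa pa; apply: rV4P; rewrite /c !coordE ?a0 ?p0 ?x0; ring.
by rewrite aa pa !mulr0 !subr0 mul1r.
Qed.

Lemma det4E (R : realType) (x y z w : 'rV[R]_4) : det4 x y z w =
  x 0 0 * (y 0 1 * (z 0 2 * w 0 3 - z 0 3 * w 0 2)
     - y 0 2 * (z 0 1 * w 0 3 - z 0 3 * w 0 1)
     + y 0 3 * (z 0 1 * w 0 2 - z 0 2 * w 0 1))
  - x 0 1 * (y 0 0 * (z 0 2 * w 0 3 - z 0 3 * w 0 2)
     - y 0 2 * (z 0 0 * w 0 3 - z 0 3 * w 0 0)
     + y 0 3 * (z 0 0 * w 0 2 - z 0 2 * w 0 0))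
  + x 0 2 * (y 0 0 * (z 0 1 * w 0 3 - z 0 3 * w 0 1)
     - y 0 1 * (z 0 0 * w 0 3 - z 0 3 * w 0 0)
     + y 0 3 * (z 0 0 * w 0 1 - z 0 1 * w 0 0))
  - x 0 3 * (y 0 0 * (z 0 1 * w 0 2 - z 0 2 * w 0 1)
     - y 0 1 * (z 0 0 * w 0 2 - z 0 2 * w 0 0)
     + y 0 2 * (z 0 0 * w 0 1 - z 0 1 * w 0 0)).
Proof.
rewrite /det4.
(* Entries are indexed by natural numbers so that the lifted indices of the nested cofactors compute
   before returning to ['I_4]. *)
pose f (i j : nat) := nth 0 [:: x; y; z; w] i 0 (inord j).
transitivity (\det (\matrix_(i < 4, j < 4) f i j)).
  by congr (\det _); apply/matrixP => i j; rewrite !mxE /f inord_val.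
rewrite (expand_det_row _ 0) !big_ord_recl big_ord0 /cofactor.
rewrite !(expand_det_row _ ord0) !big_ord_recl !big_ord0 /cofactor.
rewrite !(expand_det_row _ ord0) !big_ord_recl !big_ord0 /cofactor !det_mx11.
rewrite !mxE /= /bump /= !(addn0, add0n, add1n) /f /=.
have -> : inord 0 = 0 :> 'I_4 by apply: val_inj; rewrite /= inordK.
have -> : inord 1 = 1 :> 'I_4 by apply: val_inj; rewrite /= inordK.
have -> : inord 2 = 2 :> 'I_4 by apply: val_inj; rewrite /= inordK.
have -> : inord 3 = 3 :> 'I_4 by apply: val_inj; rewrite /= inordK.
ring.
Qed.

(* Left multiplication by q scales det4 by the determinant |q|^4, and the frame
   a, p, a x p is positively oriented. *)
Lemma det4_frame (R : realType) (q a p : 'rV[R]_4) : a 0 0 = 0 -> p 0 0 = 0 ->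
  det4 q (qmul q a) (qmul q p) (qmul q (qmul a p)) =
  dot q q ^+ 2 * (dot a a * dot p p - dot p a ^+ 2).
Proof. by move=> a0 p0; rewrite det4E !coordE a0 p0; ring. Qed.

Lemma det4Zr (R : realType) (h k : R) (x y z w : 'rV[R]_4) :
  det4 x y (h *: z) (k *: w) = h * k * det4 x y z w.
Proof. by rewrite !det4E !coordE; ring. Qed.

(** Conjugation is a linear involution of determinant -1; applying it to all four arguments moves it
    to the last one and changes the sign. *)
Lemma det4_qconj (R : realType) (x y z w : 'rV[R]_4) :
  det4 (qconj x) (qconj y) (qconj z) w = det4 x y z (- qconj w).
Proof. by rewrite !det4E !coordE; ring. Qed.

(** * Derivatives of quaternion-valued maps *)

Lemma is_derive_coordP (R : realType) (V : normedModType R)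
    (f : V -> 'rV[R]_4) (x v : V) (df : 'rV[R]_4) :
  is_derive x v f df <->
  forall i, is_derive x v (fun t => f t 0 i) (df 0 i).
Proof.
split=> [[fx <-] i|fx].
  have fxi : derivable (fun t => f t 0 i) x v.
    exact: ((derivable_mxP f x v).1 fx).
  by apply: DeriveDef => //; rewrite derive_mx// mxE.
have dfx : derivable f x v.
  by apply/derivable_mxP => i j; rewrite (ord1 i); have [] := fx j.
apply: DeriveDef => //; rewrite derive_mx//; apply/rowP => i; rewrite mxE.
exact: derive_val.
Qed.

Lemma is_derive_qmul (R : realType) (V : normedModType R)
    (f g : V -> 'rV[R]_4) (x v : V) (df dg : 'rV[R]_4) :
  is_derive x v f df -> is_derive x v g dg ->
  is_derive x v (fun t => qmul (f t) (g t)) (qmul df (g x) + qmul (f x) dg).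
Proof.
move=> /is_derive_coordP dfx /is_derive_coordP dgx.
pose F i : V -> R := fun t => f t 0 i.
pose G i : V -> R := fun t => g t 0 i.
have dF i : is_derive x v (F i) (df 0 i) by exact: dfx.
have dG i : is_derive x v (G i) (dg 0 i) by exact: dgx.
have dM i j := is_deriveM (dF i) (dG j).
apply/is_derive_coordP; apply: I4_case; rewrite !coordE.
- have -> : (fun t => qmul (f t) (g t) 0 0)
      = F 0 * G 0 - F 1 * G 1 - F 2 * G 2 - F 3 * G 3.
    by apply/funext => t; rewrite !coordE.
  apply: (is_derive_eq
    (is_deriveB (is_deriveB (is_deriveB (dM 0 0) (dM 1 1)) (dM 2 2)) (dM 3 3))).
  by rewrite /GRing.scale /= /F /G; move: (f x) (g x) => a b; ring.
- have -> : (fun t => qmul (f t) (g t) 0 1)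
      = F 0 * G 1 + F 1 * G 0 + F 2 * G 3 - F 3 * G 2.
    by apply/funext => t; rewrite !coordE.
  apply: (is_derive_eq
    (is_deriveB (is_deriveD (is_deriveD (dM 0 1) (dM 1 0)) (dM 2 3)) (dM 3 2))).
  by rewrite /GRing.scale /= /F /G; move: (f x) (g x) => a b; ring.
- have -> : (fun t => qmul (f t) (g t) 0 2)
      = F 0 * G 2 - F 1 * G 3 + F 2 * G 0 + F 3 * G 1.
    by apply/funext => t; rewrite !coordE.
  apply: (is_derive_eq
    (is_deriveD (is_deriveD (is_deriveB (dM 0 2) (dM 1 3)) (dM 2 0)) (dM 3 1))).
  by rewrite /GRing.scale /= /F /G; move: (f x) (g x) => a b; ring.
- have -> : (fun t => qmul (f t) (g t) 0 3)
      = F 0 * G 3 + F 1 * G 2 - F 2 * G 1 + F 3 * G 0.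
    by apply/funext => t; rewrite !coordE.
  apply: (is_derive_eq
    (is_deriveD (is_deriveB (is_deriveD (dM 0 3) (dM 1 2)) (dM 2 1)) (dM 3 0))).
  by rewrite /GRing.scale /= /F /G; move: (f x) (g x) => a b; ring.
Qed.

Lemma is_derive_dot (R : realType) (V : normedModType R)
    (f g : V -> 'rV[R]_4) (x v : V) (df dg : 'rV[R]_4) :
  is_derive x v f df -> is_derive x v g dg ->
  is_derive x v (fun t => dot (f t) (g t)) (dot df (g x) + dot (f x) dg).
Proof.
move=> /is_derive_coordP dfx /is_derive_coordP dgx.
pose F i : V -> R := fun t => f t 0 i.
pose G i : V -> R := fun t => g t 0 i.
have dF i : is_derive x v (F i) (df 0 i) by exact: dfx.
have dG i : is_derive x v (G i) (dg 0 i) by exact: dgx.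
have dM i j := is_deriveM (dF i) (dG j).
have -> : (fun t => dot (f t) (g t))
    = F 0 * G 0 + F 1 * G 1 + F 2 * G 2 + F 3 * G 3.
  by apply/funext => t; rewrite !coordE.
apply: (is_derive_eq (is_deriveD (is_deriveD (is_deriveD (dM 0 0) (dM 1 1))
  (dM 2 2)) (dM 3 3))).
rewrite !coordE /GRing.scale /= /F /G; ring.
Qed.

Lemma is_derive_qconj (R : realType) (V : normedModType R)
    (f : V -> 'rV[R]_4) (x v : V) (df : 'rV[R]_4) :
  is_derive x v f df -> is_derive x v (fun t => qconj (f t)) (qconj df).
Proof.
move=> /is_derive_coordP dfx.
pose F i : V -> R := fun t => f t 0 i.
have dF i : is_derive x v (F i) (df 0 i) by exact: dfx.
apply/is_derive_coordP; apply: I4_case; rewrite !coordE.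
- have -> : (fun t => qconj (f t) 0 0) = F 0.
    by apply/funext => t; rewrite !coordE.
  exact: dF.
- have -> : (fun t => qconj (f t) 0 1) = - F 1.
    by apply/funext => t; rewrite !coordE.
  exact: is_deriveN.
- have -> : (fun t => qconj (f t) 0 2) = - F 2.
    by apply/funext => t; rewrite !coordE.
  exact: is_deriveN.
- have -> : (fun t => qconj (f t) 0 3) = - F 3.
    by apply/funext => t; rewrite !coordE.
  exact: is_deriveN.
Qed.

Lemma is_derive_scale (R : realType) (V : normedModType R)
    (k : V -> R) (f : V -> 'rV[R]_4) (x v : V) (dk : R) (df : 'rV[R]_4) :
  is_derive x v k dk -> is_derive x v f df ->
  is_derive x v (fun t => k t *: f t) (dk *: f x + k x *: df).
Proof.
move=> dkx /is_derive_coordP dfx; apply/is_derive_coordP => i.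
pose F : V -> R := fun t => f t 0 i.
have dF : is_derive x v F (df 0 i) by exact: dfx.
have -> : (fun t => (k t *: f t) 0 i) = k * F.
  by apply/funext => t; rewrite mxE.
apply: (is_derive_eq (is_deriveM dkx dF)).
by rewrite !mxE /GRing.scale /= /F; ring.
Qed.

(** Curves are constrained only on an open interval, so their derivatives are read off from formulas
    valid near the point. *)
Lemma is_derive_open (R : realType) (V : normedModType R) (I : set R)
    (f g : R -> V) (s : R) (df : V) :
  open I -> I s -> (forall t, I t -> f t = g t) ->
  is_derive s 1 f df -> is_derive s 1 g df.
Proof.
move=> oI Is fg; apply: near_eq_is_derive.
by have := open_nbhs_nbhs (conj oI Is); apply: filterS.
Qed.

(** Source of the orthogonality relations below: each comes from differentiating a quantity that is
    constant on an open set. *)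
Lemma is_derive_open_cst (R : realType) (V : normedModType R) (I : set R)
    (f : R -> V) (c : V) (s : R) (df : V) :
  open I -> I s -> (forall t, I t -> f t = c) -> is_derive s 1 f df -> df = 0.
Proof.
move=> oI Is fc df_s; have := is_derive_open oI Is fc df_s.
by move=> ?; rewrite -(derive_cst c s 1) derive_val.
Qed.

Lemma is_derive_derive1 (R : realType) (V : normedModType R) (f : R -> V)
    (s : R) (df : V) :
  is_derive s 1 f df -> derive1 f s = df.
Proof. by move=> ?; rewrite derive1E derive_val. Qed.

Lemma derivable_is_derive1 (R : realType) (V : normedModType R) (f : R -> V)
    (s : R) :
  derivable f s 1 -> is_derive s 1 f (derive1 f s).
Proof. by move=> fs; rewrite derive1E; exact/derivableP. Qed.

Lemma derive1_open_cst (R : realType) (V : normedModType R) (I : set R)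
    (f : R -> V) (c : V) (s : R) :
  open I -> I s -> (forall t, I t -> f t = c) -> derive1 f s = 0.
Proof.
move=> oI Is fc; apply: is_derive_derive1.
by apply: (is_derive_open oI Is) (is_derive_cst c _ _) => t /fc.
Qed.

(** * Linear vector fields as Killing fields *)

Lemma is_derive_linear (R : realType) (m n : nat)
    (L : 'rV[R]_m.+1 -> 'rV[R]_n.+1) (p v : 'rV[R]_m.+1) :
  linear L -> differentiable L p /\ is_derive p v L (L v).
Proof.
move=> linL; pose LM := GRing.isLinear.Build _ _ _ _ L linL.
pose L' : {linear 'rV[R]_m.+1 -> 'rV[R]_n.+1} := HB.pack L LM.
(* In finite dimension [L] is a sum of coordinates times the rows of its matrix. *)
have dL q : differentiable L q.
  pose F k (q : 'rV[R]_m.+1) := q 0 k *: row k (lin1_mx L').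
  have -> : L = \sum_(k < m.+1) F k.
    apply/funext => x.
    by rewrite fct_sumE -[L x]/(L' x) -mul_rV_lin1 mulmx_sum_row.
  apply: differentiable_sum => k.
  exact/differentiableZl/differentiable_coord.
split; first exact: dL.
apply: DeriveDef; first exact/diff_derivable/dL.
rewrite deriveE; last exact: dL.
have cL : continuous L' by move=> q; exact/differentiable_continuous/dL.
by rewrite -[L]/(L' : _ -> _) diff_lin.
Qed.

Lemma smooth_field_linear (R : realType) (L : 'rV[R]_4 -> 'rV[R]_4) :
  linear L -> smooth_field L.
Proof.
move=> linL us p.
(* The invariant is linear plus constant: a directional derivative turns such a field into a
   constant one, which again has this form. *)
suff [M [b [linM ->]]] : exists M b, linear M /\
    foldr (fun v F q => derive F q v) L us = M + cst b.
  apply: differentiableD; last exact: differentiable_cst.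
  by have [] := is_derive_linear p 0 linM.
elim: us => [|v us [M [b [linM IH]]]] /=.
  by exists L, 0; split=> //; apply/funext => q /=; rewrite fctE addr0.
exists (cst 0), (M v); split=> [k x y|]; first by rewrite scaler0 addr0.
apply/funext => q; rewrite IH.
have [_ ?] := is_derive_linear q v linM.
have ? := is_derive_cst b q v.
by rewrite derive_val !fctE addr0 add0r.
Qed.

(** A skew-symmetric endomorphism generates rotations of the sphere; the Killing equation is the
    polarization of <L p, p> = 0. *)
Lemma killing_field_linear (R : realType) (L : 'rV[R]_4 -> 'rV[R]_4) :
  linear L -> (forall p, dot (L p) p = 0) -> killing_field L.
Proof.
move=> linL skewL; split=> [|p _|p x y _ _ _]; first exact: smooth_field_linear.
  exact: skewL.
have [_ ?] := is_derive_linear p x linL.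
have [_ ?] := is_derive_linear p y linL.
(* The scalar 1 gives the sum the shape in which linearity of [L] is stated. *)
rewrite !derive_val; have := skewL (1 *: x + y).
by rewrite linL !scale1r dotDl !dotDr !skewL add0r addr0 [dot (L y) x]dotC.
Qed.

(** * The logarithmic derivative T of a curve g and the Frenet data in terms of T *)

Lemma is_derive_open_imag (R : realType) (I : set R) (f : R -> 'rV[R]_4)
    (s : R) (df : 'rV[R]_4) :
  open I -> I s -> (forall t, I t -> f t 0 0 = 0) -> is_derive s 1 f df ->
  df 0 0 = 0.
Proof.
move=> oI Is f0 /is_derive_coordP/(_ 0); exact: (is_derive_open_cst oI Is f0).
Qed.

Lemma is_derive_open_dot (R : realType) (I : set R) (f g : R -> 'rV[R]_4)
    (c s : R) (df dg : 'rV[R]_4) :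
  open I -> I s -> (forall t, I t -> dot (f t) (g t) = c) ->
  is_derive s 1 f df -> is_derive s 1 g dg ->
  dot df (g s) + dot (f s) dg = 0.
Proof.
move=> oI Is fgc dfs dgs.
exact: (is_derive_open_cst oI Is fgc (is_derive_dot dfs dgs)).
Qed.

Lemma arc_length_derivable (R : realType) (I : set R) (g : R -> 'rV[R]_4)
    (n : nat) (s : R) :
  arc_length_curve I g -> I s ->
  is_derive s 1 (derive1n n g) (derive1n n.+1 g s).
Proof. by move=> [sg _ _] Is; exact/derivable_is_derive1/sg. Qed.

Lemma arc_length_dot (R : realType) (I : set R) (g : R -> 'rV[R]_4) (s : R) :
  arc_length_curve I g -> I s ->
  dot (g s) (g s) = 1 /\ dot (derive1 g s) (derive1 g s) = 1.
Proof.
by move=> [_ g1 g'1] Is; split; apply/enorm_eq1; [exact: g1|exact: g'1].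
Qed.

(** The real part of T is <g, g'>, half the derivative of the constant |g|^2. *)
Lemma T_first_imag (R : realType) (I : set R) (g : R -> 'rV[R]_4) (s : R) :
  open I -> arc_length_curve I g -> I s -> T_first g s 0 0 = 0.
Proof.
move=> oI ag Is; have dg := arc_length_derivable 0 ag Is.
have gg t : I t -> dot (g t) (g t) = 1 by move=> /(arc_length_dot ag)[].
have /eqP := is_derive_open_dot oI Is gg dg dg.
rewrite dotC -mulr2n mulrn_eq0/= => /eqP <-.
by rewrite /T_first !coordE; ring.
Qed.

Lemma T_first_unit (R : realType) (I : set R) (g : R -> 'rV[R]_4) (s : R) :
  arc_length_curve I g -> I s -> dot (T_first g s) (T_first g s) = 1.
Proof.
move=> ag Is; have [gg g'g'] := arc_length_dot ag Is.
by rewrite dot_qmul2l dot_qconj gg g'g' mulr1.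
Qed.

Lemma derive1_T_first (R : realType) (I : set R) (g : R -> 'rV[R]_4) (s : R) :
  arc_length_curve I g -> I s -> derive1 g s = qmul (g s) (T_first g s).
Proof.
by move=> ag Is; have [gg _] := arc_length_dot ag Is; rewrite qmulKl gg scale1r.
Qed.

Lemma is_derive_curve (R : realType) (I : set R) (g : R -> 'rV[R]_4) (s : R) :
  arc_length_curve I g -> I s -> is_derive s 1 g (qmul (g s) (T_first g s)).
Proof.
move=> ag Is; have := arc_length_derivable 0 ag Is.
by rewrite -(derive1_T_first ag Is).
Qed.

Lemma is_derive_T_first (R : realType) (I : set R) (g : R -> 'rV[R]_4)
    (s : R) :
  arc_length_curve I g -> I s ->
  is_derive s 1 (T_first g) (derive1 (T_first g) s).
Proof.
move=> ag Is; apply: derivable_is_derive1.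
have [+ _] := is_derive_qmul (is_derive_qconj (arc_length_derivable 0 ag Is))
  (arc_length_derivable 1 ag Is).
exact.
Qed.

Lemma is_derive_derive1_T_first (R : realType) (I : set R)
    (g : R -> 'rV[R]_4) (s : R) :
  open I -> arc_length_curve I g -> I s ->
  is_derive s 1 (derive1 (T_first g)) (derive1 (derive1 (T_first g)) s).
Proof.
move=> oI ag Is; apply: derivable_is_derive1.
have d0 := arc_length_derivable 0 ag; have d1 := arc_length_derivable 1 ag.
(* Expressing T' on [I] through g, g' and g'' makes it differentiable by the product rule, with the
   third derivative of g entering. *)
have T't t : I t -> qmul (qconj (derive1 g t)) (derive1 g t)
    + qmul (qconj (g t)) (derive1n 2 g t) = derive1 (T_first g) t.
  move=> It; apply/esym/is_derive_derive1.
  exact: is_derive_qmul (is_derive_qconj (d0 _ It)) (d1 _ It).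
have [+ _] := is_derive_open oI Is T't (is_deriveD
  (is_derive_qmul (is_derive_qconj (d1 _ Is)) (d1 _ Is))
  (is_derive_qmul (is_derive_qconj (d0 _ Is)) (arc_length_derivable 2 ag Is))).
exact.
Qed.

Lemma derive1_T_first_imag (R : realType) (I : set R) (g : R -> 'rV[R]_4)
    (s : R) :
  open I -> arc_length_curve I g -> I s -> derive1 (T_first g) s 0 0 = 0.
Proof.
move=> oI ag Is; apply: (is_derive_open_imag oI Is) (is_derive_T_first ag Is).
by move=> t; exact: T_first_imag.
Qed.

Lemma dot_derive1_T_first (R : realType) (I : set R) (g : R -> 'rV[R]_4)
    (s : R) :
  open I -> arc_length_curve I g -> I s ->
  dot (derive1 (T_first g) s) (T_first g s) = 0.
Proof.
move=> oI ag Is; have dT := is_derive_T_first ag Is.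
have /eqP := is_derive_open_dot oI Is (fun _ => T_first_unit ag) dT dT.
by rewrite [X in _ + X]dotC -mulr2n mulrn_eq0/= => /eqP.
Qed.

(** From g' = g T follows g'' = - g + g T'. The projection removes the normal term - g and keeps g
    T', which is tangent because T' is imaginary. *)
Lemma cov_derive1 (R : realType) (I : set R) (g : R -> 'rV[R]_4) (s : R) :
  open I -> arc_length_curve I g -> I s ->
  cov g (derive1 g) s = qmul (g s) (derive1 (T_first g) s).
Proof.
move=> oI ag Is; have [gg _] := arc_length_dot ag Is.
have T0 := T_first_imag oI ag Is; have T1 := T_first_unit ag Is.
have T'0 := derive1_T_first_imag oI ag Is.
have gT t : I t -> qmul (g t) (T_first g t) = derive1 g t.
  by move=> It; rewrite (derive1_T_first ag It).
have := is_derive_open oI Is gT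
  (is_derive_qmul (is_derive_curve ag Is) (is_derive_T_first ag Is)).
rewrite /cov => /is_derive_derive1 ->.
rewrite -qmulA qmul_sqr_imag// T1 dotDl dotZl dot_qmul_l gg T'0.
by rewrite mulr1 mulr0 addr0 !scaleN1r opprK addrC addNKr.
Qed.

Lemma curvature_T_first (R : realType) (I : set R) (g : R -> 'rV[R]_4)
    (s : R) :
  open I -> arc_length_curve I g -> I s ->
  curvature g s = enorm (derive1 (T_first g) s).
Proof.
move=> oI ag Is; have [gg _] := arc_length_dot ag Is.
by rewrite /curvature (cov_derive1 oI ag Is) /enorm dot_qmul2l gg mul1r.
Qed.

Lemma is_derive_invr_enorm (R : realType) (f : R -> 'rV[R]_4) (s : R)
    (df : 'rV[R]_4) :
  f s != 0 -> is_derive s 1 f df ->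
  is_derive s 1 (fun t => (enorm (f t))^-1)
    (- (enorm (f s) ^- 3 * dot df (f s))).
Proof.
move=> fs0 dfs; have ff0 : 0 < dot (f s) (f s).
  by rewrite lt_neqAle eq_sym dot_eq0 fs0 dot_ge0.
have n0 : enorm (f s) != 0 by rewrite enorm_eq0.
have dn := @is_derive1_comp R Num.sqrt (fun t => dot (f t) (f t)) s _ _
  (is_derive1_sqrt ff0) (is_derive_dot dfs dfs).
have [dn1 dn2] := dn.
have di := @derivableV R R^o _ s 1 n0 dn1.
apply: (DeriveDef di); rewrite (@deriveV R R^o _ s 1 n0 dn1) dn2.
rewrite [dot (f s) df]dotC /GRing.scale /= -!/(enorm (f s)).
by field.
Qed.

Lemma is_derive_normal (R : realType) (I : set R) (g : R -> 'rV[R]_4) (s : R) :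
  open I -> arc_length_curve I g -> I s -> curvature g s != 0 ->
  let A := T_first g s in
  let A1 := derive1 (T_first g) s in
  let A2 := derive1 (derive1 (T_first g)) s in
  is_derive s 1 (normal g)
    (- (curvature g s ^- 3 * dot A2 A1) *: qmul (g s) A1
     + (curvature g s)^-1 *: (qmul (g s) (qmul A A1) + qmul (g s) A2)).
Proof.
move=> oI ag Is; rewrite (curvature_T_first oI ag Is) enorm_eq0 => A10 /=.
(* This also holds at zeros of the curvature, where both sides carry the inverse of 0, which is 0;
   so it can be differentiated on [I]. *)
have ng t : I t -> (enorm (derive1 (T_first g) t))^-1
    *: qmul (g t) (derive1 (T_first g) t) = normal g t.
  move=> It.
  by rewrite /normal (curvature_T_first oI ag It) (cov_derive1 oI ag It).
rewrite qmulA; apply: (is_derive_open oI Is ng).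
have dA1 := is_derive_derive1_T_first oI ag Is.
apply: is_derive_scale; first exact: is_derive_invr_enorm.
exact: is_derive_qmul (is_derive_curve ag Is) dA1.
Qed.

(** * Curves for which T has constant inner product with a fixed vector u *)

(** Differentiating <T, u> = C twice gives <T', u> = <T'', u> = 0, so u lies in the span of T and T
    T'. This determines <T'', T T'>, and tau = <T'', T T'> / kappa^2 + 1, where the summand 1 comes
    from differentiating the factor g in n = g T' / kappa. *)
Lemma is_torsion_constant_angle (R : realType) (I : set R)
    (g : R -> 'rV[R]_4) (u : 'rV[R]_4) (C s : R) :
  open I -> arc_length_curve I g -> u 0 0 = 0 -> dot u u = 1 ->
  (forall t, I t -> dot (T_first g t) u = C) -> C ^+ 2 != 1 ->
  I s -> curvature g s != 0 ->
  let eta := dot u (qmul (T_first g s) (derive1 (T_first g) s))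
             / curvature g s in
  eta ^+ 2 = 1 - C ^+ 2 /\ is_torsion g s (C / eta * curvature g s + 1).
Proof.
move=> oI ag u0 uu TuC C1 Is k0; have [gg g'g'] := arc_length_dot ag Is.
have T0 := T_first_imag oI ag Is; have TT := T_first_unit ag Is.
have T'0 := derive1_T_first_imag oI ag Is.
have dT := is_derive_T_first ag Is.
have dT' := is_derive_derive1_T_first oI ag Is.
have T'T := dot_derive1_T_first oI ag Is.
have T''0 := is_derive_open_imag oI Is
  (fun _ => derive1_T_first_imag oI ag) dT'.
have T''T := is_derive_open_dot oI Is
  (fun _ => dot_derive1_T_first oI ag) dT' dT.
have Tu := TuC s Is.
have T'uC t : I t -> dot (derive1 (T_first g) t) u = 0.
  move=> It; have := is_derive_open_dot oI It TuC (is_derive_T_first ag It)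
    (is_derive_cst u t 1).
  by rewrite dot0r addr0.
have T'u := T'uC s Is.
have T''u : dot (derive1 (derive1 (T_first g)) s) u = 0.
  have := is_derive_open_dot oI Is T'uC dT' (is_derive_cst u s 1).
  by rewrite dot0r addr0.
have dn := is_derive_normal oI ag Is k0; move: dn => /=.
have kq : curvature g s ^+ 2 =
    dot (derive1 (T_first g) s) (derive1 (T_first g) s).
  by rewrite (curvature_T_first oI ag Is) enorm_sqr.
have g'E := derive1_T_first ag Is.
have nE : normal g s = (curvature g s)^-1 *: qmul (g s) (derive1 (T_first g) s).
  by rewrite /normal (cov_derive1 oI ag Is).
move: kq T0 TT T'0 T''0 T'T T''T Tu T'u T''u g'E nE.
set A := T_first g s; 
  set A1 : 'rV[R]_4 := derive1 _ s; set A2 : 'rV[R]_4 := derive1 _ s.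
set k := curvature g s => kq A0 AA A10 A20 A1A A2A Au A1u A2u g'E nE dn.
clearbody A A1 A2.
set P := qmul A A1; set w := dot u P.
have PP : dot P P = k ^+ 2 by rewrite dot_qmul2l AA mul1r kq.
have frame (x : 'rV[R]_4) : x 0 0 = 0 -> k ^+ 2 *: x =
    (k ^+ 2 * dot x A) *: A + dot x A1 *: A1 + dot x P *: P.
  by move=> x0; rewrite kq (frame_decomp A0 A10 x0).
have uP : k ^+ 2 *: u = (k ^+ 2 * C) *: A + w *: P.
  by rewrite (frame _ u0) (dotC u A) (dotC u A1) Au A1u scale0r addr0.
(* Pairing the expansion of u with u itself. *)
have ww : w ^+ 2 = k ^+ 2 * (1 - C ^+ 2).
  have := congr1 (fun v => @dot R v u) uP.
  rewrite /= dotDl !dotZl uu Au (dotC P) -/w => E.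
  by rewrite mulrBr E; ring.
have w0 : w != 0.
  by rewrite -sqrf_eq0 ww mulf_neq0 ?expf_neq0// subr_eq0 eq_sym.
(* Pairing the expansion of u with T'', where <T'', T> = - kappa^2 by differentiating <T', T> =
   0. *)
have vw : dot A2 P = k ^+ 4 * C / w.
  have := congr1 (dot A2) uP.
  rewrite dotDr !dotZr A2u (_ : dot A2 A = - k ^+ 2); last first.
    by apply/eqP; rewrite kq -addr_eq0 A2A.
  rewrite mulr0 => /eqP; rewrite eq_sym addrC addr_eq0 => /eqP E.
  by apply: (mulfI w0); rewrite E; field.
have A2E : A2 = - k ^+ 2 *: A + (dot A2 A1 / k ^+ 2) *: A1
    + (k ^+ 2 * C / w) *: P.
  have k2 : k ^+ 2 != 0 by rewrite expf_neq0.
  apply: (scalerI k2); rewrite (frame _ A20) vw.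
  rewrite (_ : dot A2 A = - k ^+ 2); last first.
    by apply/eqP; rewrite kq -addr_eq0 A2A.
  rewrite !scalerDr !scalerA.
  by congr (_ *: _ + _ *: _ + _ *: _); field; rewrite ?k0 ?w0.
have P0 : P 0 0 = 0.
  transitivity (- dot A1 A); last by rewrite A1A oppr0.
  by rewrite /P !coordE A0 A10; ring.
split; first by rewrite exprMn exprVn ww mulrAC divff ?expf_neq0// mul1r.
(* The binormal is the left translate by g of the unit vector T T' / kappa. *)
split=> //; exists (k^-1 *: qmul (g s) P).
  have PA : dot P A = 0.
    transitivity (dot A A * A1 0 0); last by rewrite A10 mulr0.
    by rewrite /P dot_qmul_l.
  have PA1 : dot P A1 = 0.
    transitivity (A 0 0 * dot A1 A1); last by rewrite A0 mul0r.
    by rewrite /P !coordE; ring.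
  split.
  - by rewrite dotZl dot_qmul_l P0 !mulr0.
  - by rewrite g'E dotZl dot_qmul2l PA !mulr0.
  - by rewrite nE dotZl dotZr dot_qmul2l PA1 !mulr0.
  - by apply/enorm_eq1; rewrite dotZl dotZr dot_qmul2l gg PP; field.
  - rewrite g'E nE det4Zr det4_frame// gg AA -kq A1A.
    by rewrite (_ : _ * _ = 1) ?ltr01//; field.
rewrite /cov (is_derive_derive1 dn) g'E.
(* The derivative of n is g times an imaginary quaternion, hence already tangent to the sphere. *)
set X := - _ *: _ + _; have -> : dot X (g s) = 0.
  rewrite /X dotDl !dotZl dotDl !dot_qmul_l A10 A20 gg.
  by rewrite -/P P0; ring.
rewrite scale0r subr0 /X -/P {2}A2E !qmulDr !qmulZr.
move: (qmul (g s) A) (qmul (g s) A1) (qmul (g s) P) => U V W.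
by apply/rowP => i; rewrite !mxE -/k; field; rewrite k0 w0.
Qed.

(** Opposite signs would give a zero in between, by the intermediate value theorem. *)
Lemma interval_same_sign (R : realType) (K : set R) (f : R -> R) (a b : R) :
  is_interval K -> (forall t, K t -> derivable f t 1) ->
  (forall t, K t -> f t != 0) -> K a -> K b -> 0 < f a * f b.
Proof.
move=> iK df f0; wlog ab : a b / a <= b => [th|] Ka Kb.
  by have [/th|/ltW/th] := leP a b; [apply|rewrite mulrC; apply].
have Kab t : t \in `[a, b] -> K t by rewrite in_itv/=; apply: iK.
rewrite ltNge; apply/negP => fab.
have [||c /Kab Kc fc] := @IVT R f a b 0 ab.
- by apply: derivable_within_continuous => t /Kab /df.
- rewrite ge_min le_max; move: fab.
  by case: (ltgtP (f a) 0) (f0 a Ka) => //= fa _;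
    [rewrite nmulr_rle0//|rewrite pmulr_rle0//] => ->; rewrite ?orbT.
- by move: (f0 c Kc); rewrite fc eqxx.
Qed.

(** The pointwise eta has the constant nonzero square 1 - C^2, and its sign cannot change on [K];
    hence eta is constant there. *)
Lemma constant_angle_torsion (R : realType) (I : set R) (g : R -> 'rV[R]_4)
    (u : 'rV[R]_4) (C : R) (K : set R) :
  open I -> arc_length_curve I g -> u 0 0 = 0 -> dot u u = 1 ->
  (forall t, I t -> dot (T_first g t) u = C) -> C ^+ 2 != 1 ->
  is_interval K -> K `<=` I -> (forall s, K s -> curvature g s != 0) ->
  exists2 eta : R, eta != 0 &
    forall s, K s -> is_torsion g s (C / eta * curvature g s + 1).
Proof.
move=> oI ag u0 uu TuC C1 iK KI k0.
(* On the empty interval any nonzero eta will do. *)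
have [->|/set0P[s0 Ks0]] := eqVneq K set0; first by exists 1; rewrite ?oner_eq0.
pose w s := dot u (qmul (T_first g s) (derive1 (T_first g) s)).
pose eta s := w s / curvature g s.
have etaP s : K s -> eta s ^+ 2 = 1 - C ^+ 2 /\
    is_torsion g s (C / eta s * curvature g s + 1).
  move=> Ks.
  exact: (is_torsion_constant_angle oI ag u0 uu TuC C1 (KI s Ks) (k0 s Ks)).
have eta0 s : K s -> eta s != 0.
  by move=> /etaP[e2 _]; rewrite -sqrf_eq0 e2 subr_eq0 eq_sym.
have w0 s : K s -> w s != 0.
  by move=> /eta0; apply: contraNneq; rewrite /eta => ->; rewrite mul0r.
have dw s : K s -> derivable w s 1.
  move=> /KI Is.
  by have [] := is_derive_dot (is_derive_cst u s 1) (is_derive_qmul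
    (is_derive_T_first ag Is) (is_derive_derive1_T_first oI ag Is)).
exists (eta s0) => [|s Ks]; first exact: eta0.
suff -> : eta s0 = eta s by have [] := etaP s Ks.
(* The sign is controlled for the differentiable function [w] and passes to [eta] because the
   curvature is positive on [K]. *)
have : 0 < eta s0 * eta s.
  rewrite /eta mulrACA mulr_gt0 ?(interval_same_sign iK dw w0)//.
  by rewrite mulr_gt0// invr_gt0 lt_neqAle eq_sym k0//= sqrtr_ge0.
have /eqP : eta s0 ^+ 2 = eta s ^+ 2.
  by rewrite (etaP s0 Ks0).1 (etaP s Ks).1.
rewrite eqf_sqr => /orP[/eqP//|/eqP ->].
by rewrite mulNr oppr_gt0 -expr2 ltNge sqr_ge0.
Qed.

(** Expansion of |x + y|^2 >= 0 and |x - y|^2 >= 0. *)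
Lemma dot_unit_bound (R : realType) (x y : 'rV[R]_4) :
  dot x x = 1 -> dot y y = 1 -> -1 <= dot x y <= 1.
Proof.
move=> xx yy; have := dot_ge0 (x + y); have := dot_ge0 (x + -1 *: y).
rewrite !(dotDl, dotDr, dotZl, dotZr) xx yy (dotC y x); lra.
Qed.

(** [L] serves as the axis, of length 1 along the curve; the angle is acos C, which C < 1 makes
    nonzero. *)
Lemma general_helix_linear (R : realType) (I : set R) (g : R -> 'rV[R]_4)
    (L : 'rV[R]_4 -> 'rV[R]_4) (C : R) :
  arc_length_curve I g -> linear L -> (forall p, dot (L p) p = 0) ->
  (forall s, I s -> dot (L (g s)) (L (g s)) = 1) ->
  (forall s, I s -> dot (L (g s)) (derive1 g s) = C) ->
  -1 <= C < 1 -> general_helix I g.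
Proof.
move=> ag linL skewL Lg LgC C1; exists L; split.
- exact: killing_field_linear.
- by exists 1; rewrite ?ltr01// => s Is; apply/enorm_eq1/Lg.
- exists (acos C) => [|s Is]; first by rewrite gt_eqF// acos_gt0.
  have [_ /enorm_eq1 g'1] := arc_length_dot ag Is.
  by rewrite /angle LgC// g'1 (enorm_eq1 _).2 ?Lg// mulr1 divr1.
Qed.

(** * Conjugation of curves, which exchanges the two kinds of generating curves *)

Lemma derive1n_qconj (R : realType) (I : set R) (g : R -> 'rV[R]_4) (n : nat)
    (s : R) :
  open I -> smooth_on I g -> I s ->
  derive1n n (fun t => qconj (g t)) s = qconj (derive1n n g s).
Proof.
move=> oI sg; elim: n s => // n IH s Is; apply: is_derive_derive1.
apply: (is_derive_open oI Is)
  (is_derive_qconj (derivable_is_derive1 (sg n s Is))).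
by move=> t It; exact/esym/IH.
Qed.

Lemma arc_length_curve_qconj (R : realType) (I : set R) (g : R -> 'rV[R]_4) :
  open I -> arc_length_curve I g ->
  arc_length_curve I (fun t => qconj (g t)).
Proof.
move=> oI ag; have [sg g1 g'1] := ag; split=> [n s Is|s Is|s Is].
- have [+ _] : is_derive s 1 (derive1n n (fun t => qconj (g t)))
      (qconj (derive1n n.+1 g s)).
    apply: (is_derive_open oI Is)
      (is_derive_qconj (derivable_is_derive1 (sg n s Is))).
    by move=> t It; exact: esym (derive1n_qconj n oI sg It).
  exact.
- by rewrite /S3 /= /enorm dot_qconj; exact: g1.
- have := derive1n_qconj 1 oI sg Is; rewrite /derive1n /= => ->.
  by rewrite /enorm dot_qconj; exact: g'1.
Qed.

Lemma cov_qconj (R : realType) (I : set R) (g W V : R -> 'rV[R]_4) (s : R) :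
  open I -> I s -> (forall t, I t -> V t = qconj (W t)) -> derivable W s 1 ->
  cov (fun t => qconj (g t)) V s = qconj (cov g W s).
Proof.
move=> oI Is VW /derivable_is_derive1/is_derive_qconj dW.
have WV t : I t -> qconj (W t) = V t by move=> /VW.
rewrite /cov (is_derive_derive1 (is_derive_open oI Is WV dW)) dot_qconj.
by apply: rV4P; rewrite !coordE; ring.
Qed.

Lemma derive1_qconj (R : realType) (I : set R) (g : R -> 'rV[R]_4) (s : R) :
  open I -> smooth_on I g -> I s ->
  derive1 (fun t => qconj (g t)) s = qconj (derive1 g s).
Proof. exact: (@derive1n_qconj R I g 1). Qed.

Lemma cov_derive1_qconj (R : realType) (I : set R) (g : R -> 'rV[R]_4)
    (s : R) :
  open I -> smooth_on I g -> I s ->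
  cov (fun t => qconj (g t)) (derive1 (fun t => qconj (g t))) s =
  qconj (cov g (derive1 g) s).
Proof.
move=> oI sg Is; apply: (cov_qconj _ oI Is); last exact: (sg 1 s Is).
by move=> t; exact: derive1_qconj.
Qed.

Lemma curvature_qconj (R : realType) (I : set R) (g : R -> 'rV[R]_4) (s : R) :
  open I -> smooth_on I g -> I s ->
  curvature (fun t => qconj (g t)) s = curvature g s.
Proof.
move=> oI sg Is; rewrite /curvature (cov_derive1_qconj oI sg Is).
by rewrite /enorm dot_qconj.
Qed.

(* Conjugation is an orientation-reversing isometry of S^3. *)
Lemma is_torsion_qconj (R : realType) (I : set R) (g : R -> 'rV[R]_4)
    (s tau : R) :
  open I -> arc_length_curve I g -> I s ->
  is_torsion (fun t => qconj (g t)) s tau -> is_torsion g s (- tau).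
Proof.
move=> oI ag Is; have [sg _ _] := ag.
have ncj t : I t -> normal (fun t => qconj (g t)) t = qconj (normal g t).
  move=> It; rewrite /normal (curvature_qconj oI sg It).
  rewrite (cov_derive1_qconj oI sg It).
  by apply: rV4P; rewrite !coordE; ring.
rewrite /is_torsion (curvature_qconj oI sg Is) => -[k0 [b [bg bg' bn b1 bdet]]].
have [dn _] := is_derive_normal oI ag Is k0.
rewrite (cov_qconj g oI Is ncj dn) (derive1_qconj oI sg Is) => covE.
(* Conjugation reverses the orientation, so the conjugate of the binormal has to be negated; this
   flips the sign of the torsion. *)
split=> //; exists (- qconj b); first split.
- by rewrite -oppr0 -bg !coordE; ring.
- by rewrite -oppr0 -bg' (derive1_qconj oI sg Is) !coordE; ring.
- by rewrite -oppr0 -bn (ncj s Is) !coordE; ring.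
- by rewrite -b1 /enorm; congr Num.sqrt; rewrite !coordE; ring.
- move: bdet; rewrite (derive1_qconj oI sg Is) (ncj s Is).
  by rewrite det4_qconj.
rewrite -[LHS]qconjK covE.
by apply: rV4P; rewrite !coordE; ring.
Qed.

(** Carries the results on [T_first] over to the second generating curve, conjugation being an
    involution that commutes with differentiation. *)
Lemma T_second_qconj (R : realType) (I : set R) (g : R -> 'rV[R]_4) (s : R) :
  open I -> smooth_on I g -> I s ->
  T_second g s = T_first (fun t => qconj (g t)) s.
Proof.
by move=> oI sg Is; rewrite /T_first (derive1_qconj oI sg Is) qconjK.
Qed.

(** * Flatness of constant metrics and the dichotomy for the tangents *)

(** The Christoffel symbols are built from derivatives of the metric, so they vanish on the whole
    open rectangle, and with them their own derivatives and the curvature tensor. *)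
Lemma constant_metric_flat (R : realType) (I J : set R)
    (X : R -> R -> 'rV[R]_4) (G : 'I_2 -> 'I_2 -> R) :
  open I -> open J ->
  (forall i j s t, I s -> J t -> metric X i j s t = G i j) -> flat I J X.
Proof.
move=> oI oJ XG s t Is Jt.
have partial0 i (f : R -> R -> R^o) (c : R) s' t' : I s' -> J t' ->
    (forall x y, I x -> J y -> f x y = c) -> partial i f s' t' = 0.
  move=> Is' Jt' fc; rewrite /partial; case: ifP => _.
    by apply: (derive1_open_cst oI Is') => x Ix; exact: fc.
  by apply: (derive1_open_cst oJ Jt') => y Jy; exact: fc.
have chr0 k i j x y : I x -> J y -> christoffel X k i j x y = 0.
  move=> Ix Jy; rewrite /christoffel big1 ?mulr0// => l _.
  by rewrite !(partial0 _ _ _ _ _ Ix Jy (XG _ _)) addr0 subr0 mulr0.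
rewrite /gauss_curvature big1 ?mul0r// => l _.
rewrite /riemann !(partial0 _ _ _ _ _ Is Jt (chr0 _ _ _)) big1 => [|m _].
  by rewrite subrr addr0 mulr0.
by rewrite !chr0// !mul0r subrr.
Qed.

(** Suppose a' and b' are nonzero and let P = a a', q = |a'|^2. In the frame a, a', P one finds q b
    = q C a + <b, P> P and q b' = <b', P> P. Then <b, b'> = 0 forces <b, P> = 0, so b = C a and C^2
    = 1. *)
Lemma tangent_dichotomy (R : realType) (a a' b b' : 'rV[R]_4) (C : R) :
  a 0 0 = 0 -> a' 0 0 = 0 -> b 0 0 = 0 -> b' 0 0 = 0 ->
  dot a a = 1 -> dot b b = 1 -> dot a' a = 0 -> dot b' b = 0 ->
  dot a b = C -> dot a' b = 0 -> dot a b' = 0 -> dot a' b' = 0 ->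
  C ^+ 2 != 1 -> a' = 0 \/ b' = 0.
Proof.
move=> a0 a'0 b0 b'0 aa bb a'a b'b ab a'b ab' a'b' C1.
have [->|a'n0] := eqVneq a' 0; first by left.
have [->|b'n0] := eqVneq b' 0; [by right|exfalso].
set q := dot a' a'; have q0 : q != 0 by rewrite dot_eq0.
have := frame_decomp a0 a'0 b'0 aa a'a; have := frame_decomp a0 a'0 b0 aa a'a.
rewrite -/q (dotC b a) (dotC b a') (dotC b' a) (dotC b' a') ab a'b ab' a'b'.
rewrite mulr0 !scale0r !add0r addr0; set P := qmul a a' => bE b'E.
have b'P0 : dot b' P != 0.
  apply: contraNneq b'n0 => b'P; move: b'E; rewrite b'P scale0r => /eqP.
  by rewrite scaler_eq0 (negbTE q0).
have : dot b P * dot b' P = 0.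
  have := congr1 (fun v => @dot R v b') bE.
  rewrite /= dotDl !dotZl ab' (dotC b b') b'b !mulr0 add0r (dotC P b').
  by move=> <-.
move=> /eqP; rewrite mulf_eq0 (negbTE b'P0) orbF => /eqP bP.
have := congr1 (fun v => @dot R v b) bE.
rewrite bP scale0r addr0 !dotZl bb ab -mulrA -expr2 => /(mulfI q0) /esym/eqP.
by rewrite (negbTE C1).
Qed.

(** * Translation surfaces: partial derivatives and classification *)

Lemma linear_qmulr (R : realType) (u : 'rV[R]_4) : linear (fun p => qmul p u).
Proof. by move=> k x y; apply: rV4P; rewrite !coordE; ring. Qed.

Lemma linear_qmull (R : realType) (u : 'rV[R]_4) : linear (qmul u).
Proof. by move=> k x y; apply: rV4P; rewrite !coordE; ring. Qed.

Lemma partial_tsurf (R : realType) (alpha beta : R -> 'rV[R]_4) (s t : R)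
    (da db : 'rV[R]_4) :
  is_derive s 1 alpha da -> is_derive t 1 beta db ->
  partial 0 (tsurf alpha beta) s t = qmul da (beta t) /\
  partial 1 (tsurf alpha beta) s t = qmul (alpha s) db.
Proof.
move=> das dbt; split; apply: is_derive_derive1.
  apply: (is_derive_eq (is_derive_qmul das (is_derive_cst (beta t) s 1))).
  by apply: rV4P; rewrite !coordE; ring.
apply: (is_derive_eq (is_derive_qmul (is_derive_cst (alpha s) t 1) dbt)).
by apply: rV4P; rewrite !coordE; ring.
Qed.

(** With the common outer factors alpha and beta, which act isometrically, the metric reduces to
    inner products of T_alpha and T_beta. The sign arises because T_beta is imaginary: conjugating
    its definition gives beta' = - T_beta beta. *)
Lemma partial_tsurf_T (R : realType) (I J : set R) (alpha beta : R -> 'rV[R]_4)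
    (s t : R) :
  translation_surface I J alpha beta -> I s -> J t ->
  partial 0 (tsurf alpha beta) s t
    = qmul (qmul (alpha s) (T_first alpha s)) (beta t) /\
  partial 1 (tsurf alpha beta) s t
    = - qmul (qmul (alpha s) (T_second beta t)) (beta t).
Proof.
move=> [[oI _ _] [oJ _ _] aal abe _] Is Jt.
have [-> ->] := partial_tsurf (is_derive_curve aal Is)
  (arc_length_derivable 0 abe Jt).
split=> //; have [sb _ _] := abe; have ace := arc_length_curve_qconj oJ abe.
have := derive1_T_first ace Jt; rewrite (derive1_qconj oJ sb Jt).
move=> /(congr1 (@qconj R)); rewrite qconjK -(T_second_qconj oJ sb Jt).
have := T_first_imag oJ ace Jt; rewrite -(T_second_qconj oJ sb Jt).
rewrite /derive1n /=; set T := T_second beta t; clearbody T => T0 ->.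
by apply: rV4P; rewrite !coordE T0; ring.
Qed.

Theorem theorem3p3 (R : realType) (I J : set R) (alpha beta : R -> 'rV[R]_4)
    (C : R) :
  translation_surface I J alpha beta ->
  (forall s t, I s -> J t -> dot (T_first alpha s) (T_second beta t) = C) ->
  flat I J (tsurf alpha beta) /\
  (((forall t, J t -> curvature beta t = 0) /\ geodesic_or_helix I C 1 alpha) \/
   ((forall s, I s -> curvature alpha s = 0) /\
    geodesic_or_helix J C (-1) beta)).
Proof.
move=> ts TC; have [oIi oJi aal abe reg] := ts.
have [oI _ [s0 Is0]] := oIi; have [oJ _ [t0 Jt0]] := oJi.
have [sb _ _] := abe; have ace := arc_length_curve_qconj oJ abe.
set ga := fun t => qconj (beta t) in ace.
have TbE t : J t -> T_second beta t = T_first ga t.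
  by move=> Jt; exact: (T_second_qconj oJ sb Jt).
have a0 s := @T_first_imag R I alpha s oI aal.
have aa s := @T_first_unit R I alpha s aal.
have b0 t := @T_first_imag R J ga t oJ ace.
have bb t := @T_first_unit R J ga t ace.
have ab s t : I s -> J t -> dot (T_first alpha s) (T_first ga t) = C.
  by move=> Is Jt; rewrite -(TbE t Jt); exact: TC.
(* Since |T_alpha - C T_beta|^2 = 1 - C^2, the value C^2 = 1 would give T_alpha = C T_beta and the
   linear relation X_s + C X_t = 0, against regularity. *)
have C1 : C ^+ 2 != 1.
  apply/eqP => C21.
  have aE : T_first alpha s0 = C *: T_first ga t0.
    apply/eqP; rewrite -subr_eq0 -scaleN1r -dot_eq0.
    rewrite !(dotDl, dotDr, dotZl, dotZr).
    rewrite aa// bb// (dotC (T_first ga t0)) ab//; apply/eqP.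
    by transitivity (1 - C ^+ 2); [ring|rewrite C21 subrr].
  have [X0 X1] := partial_tsurf_T ts Is0 Jt0.
  have [|/eqP] := reg s0 t0 Is0 Jt0 1 C; last by rewrite oner_eq0.
  rewrite X0 X1 aE TbE//; set u := T_first ga t0; clearbody u.
  by apply: rV4P; rewrite !coordE; ring.
split.
  (* The first fundamental form has diagonal entries 1 and off-diagonal entries - C. *)
  pose G (i j : 'I_2) := if i == j then 1 else - C.
  apply: (@constant_metric_flat R I J _ G) => // i j s t Is Jt; rewrite /G.
  have [X0 X1] := partial_tsurf_T ts Is Jt.
  have [gaa _] := arc_length_dot aal Is; have [gbb _] := arc_length_dot abe Jt.
  have dotN x y : dot (- x) y = - dot x y :> R by rewrite !coordE; ring.
  have E x y : dot (qmul (qmul (alpha s) x) (beta t))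
      (qmul (qmul (alpha s) y) (beta t)) = dot x y.
    by rewrite dot_qmul2r dot_qmul2l gaa gbb mul1r mulr1.
  have I2 (k : 'I_2) : k = 0 \/ k = 1.
    by case: k => [[|[|//]] ?]; [left|right]; exact: val_inj.
  rewrite /metric; case: (I2 i) => ->; case: (I2 j) => ->; rewrite ?X0 ?X1 /=.
  - by rewrite E aa.
  - by rewrite dotC dotN E dotC TC.
  - by rewrite dotN E dotC TC.
  - by rewrite dotN dotC dotN opprK E TbE// bb.
(* This range makes acos C a nonzero angle. *)
have C11 : -1 <= C < 1.
  have := dot_unit_bound (aa _ Is0) (bb _ Jt0); rewrite ab// => /andP[-> C1'].
  by rewrite lt_neqAle C1' andbT; apply: contraNneq C1 => ->; rewrite expr1n.
(* The relation <T_alpha(s), T_beta(t)> = C is differentiated in s, in t, and in both variables. *)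
have a'b s t : I s -> J t -> dot (derive1 (T_first alpha) s) (T_first ga t) = 0.
  move=> Is Jt; have := is_derive_open_dot oI Is (fun s Is => ab s t Is Jt)
    (is_derive_T_first aal Is) (is_derive_cst (T_first ga t) s 1).
  by rewrite dot0r addr0.
have ab' s t : I s -> J t -> dot (T_first alpha s) (derive1 (T_first ga) t) = 0.
  move=> Is Jt; have := is_derive_open_dot oJ Jt (fun t Jt => ab s t Is Jt)
    (is_derive_cst (T_first alpha s) t 1) (is_derive_T_first ace Jt).
  by rewrite dotC dot0r add0r.
have a'b' s t : I s -> J t ->
    dot (derive1 (T_first alpha) s) (derive1 (T_first ga) t) = 0.
  move=> Is Jt; have := is_derive_open_dot oI Is (fun s Is => ab' s t Is Jt)
    (is_derive_T_first aal Is) (is_derive_cst (derive1 (T_first ga) t) s 1).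
  by rewrite dot0r addr0.
have kb t : J t -> curvature beta t = enorm (derive1 (T_first ga) t).
  move=> Jt; rewrite -(curvature_T_first oJ ace Jt).
  by rewrite -(curvature_qconj oJ sb Jt).
(* If the curvature of beta is nonzero at one t, the dichotomy at (s, t) gives T_alpha'(s) = 0 for
   every s. *)
have [kb0|/existsNP[t /not_implyP[Jt /eqP kt0]]] :=
  pselect (forall t, J t -> curvature beta t = 0); [left|right].
- split=> //; right; split; last first.
    by move=> K; exact: (constant_angle_torsion oI aal (b0 _ Jt0) (bb _ Jt0)
      (fun s Is => ab s t0 Is Jt0) C1).
  (* The axis of alpha is the field p -> p u with u = T_beta(t0). *)
  apply: (general_helix_linear aal (linear_qmulr (T_first ga t0)) _ _ _ C11).
  + by move=> p; rewrite dot_qmul_l b0// mulr0.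
  + move=> s Is; have [gg _] := arc_length_dot aal Is.
    by rewrite dot_qmul2l gg bb// mulr1.
  + move=> s Is; have [gg _] := arc_length_dot aal Is.
    by rewrite (derive1_T_first aal Is) dot_qmul2l gg mul1r dotC ab.
- have ba s t' : I s -> J t' -> dot (T_first ga t') (T_first alpha s) = C.
    by move=> Is Jt'; rewrite dotC ab.
  split=> [s Is|].
    have [a'0|b'0] := tangent_dichotomy (a0 _ Is)
      (derive1_T_first_imag oI aal Is) (b0 _ Jt)
      (derive1_T_first_imag oJ ace Jt) (aa _ Is) (bb _ Jt)
      (dot_derive1_T_first oI aal Is) (dot_derive1_T_first oJ ace Jt)
      (ab _ _ Is Jt) (a'b _ _ Is Jt) (ab' _ _ Is Jt) (a'b' _ _ Is Jt) C1.
      by apply/eqP; rewrite (curvature_T_first oI aal Is) enorm_eq0 a'0.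
    by move: kt0; rewrite kb// b'0 enorm_eq0 eqxx.
  right; split; last first.
    move=> K iK KJ kK.
    have [|eta eta0 tau] := constant_angle_torsion oJ ace (a0 _ Is0) (aa _ Is0)
      (fun t Jt => ba s0 t Is0 Jt) C1 iK KJ.
      by move=> t' Kt'; rewrite (curvature_qconj oJ sb (KJ _ Kt')); exact: kK.
    (* Conjugation turns (C / eta) kappa + 1 into - (C / eta) kappa - 1, whence the new sign of
       eta. *)
    exists (- eta) => [|t' Kt']; first by rewrite oppr_eq0.
    have := is_torsion_qconj oJ abe (KJ _ Kt') (tau _ Kt').
    by rewrite (curvature_qconj oJ sb (KJ _ Kt')) opprD invrN mulrN mulNr.
  (* The field p -> u p is the conjugate of p -> p T_alpha(s0), the axis for the conjugate curve;
     taking the conjugate of T_alpha(s0) makes the cosine of the angle C and not - C. *)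
  pose u := qconj (T_first alpha s0).
  apply: (general_helix_linear abe (linear_qmull u) _ _ _ C11).
  + move=> p; transitivity (u 0 0 * dot p p); first by rewrite !coordE; ring.
    by rewrite /u qconjE a0// mul0r.
  + move=> t' Jt'; have [gg _] := arc_length_dot abe Jt'.
    by rewrite dot_qmul2r /u dot_qconj aa// gg mulr1.
  + move=> t' Jt'; have [gg _] := arc_length_dot ace Jt'.
    rewrite -dot_qconj -(derive1_qconj oJ sb Jt') (derive1_T_first ace Jt').
    have -> : qconj (qmul u (beta t')) = qmul (ga t') (T_first alpha s0).
      rewrite /u /ga; move: (T_first alpha s0) (beta t') => x y.
      by apply: rV4P; rewrite !coordE; ring.
    by rewrite dot_qmul2l gg mul1r ab.
Qed.
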